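(* Let $Y=\{0,1\}\subset\mathbb{Z}$ with the $2$-adjacency of $\mathbb{Z}$. Define $\ast_1$ on $Y$ by $1\ast_1 1=0$ and $x\ast_1 0=x=0\ast_1 x$ for all $x\in Y$; and define $\star$ on $Y$ by $1\star 1=1$ and $x\star 0=0=0\star x$ for all $x\in Y$. Then $(Y,2,\ast_1,\star)$ is a $DT$-$2$-field.
   Context: Two integers are $2$-adjacent if they differ by exactly $1$. For $X\subset\mathbb{Z}$ and $x\in X$, $N_2(x,1)=\{y\in X:|x-y|\le1\}$. A map $f:(X,2)\to(X,2)$ is $2$-continuous if $f(N_2(x,1))\subset N_2(f(x),1)$ for all $x\in X$. Distinct points $p=(x_1,x_2)$, $q$ of $X^2$ are $G_4$-adjacent if $q\in(N_2(x_1,1)\times\{x_2\})\cup(\{x_1\}\times N_2(x_2,1))$; $N_{G_4}(p,1)$ is the set of points $G_4$-adjacent to $p$, together with $p$. A map $f:(X^2,G_4)\to(X,2)$ is $(G_4,2)$-continuous if $f(N_{G_4}(p,1))\subset N_2(f(p),1)$ for all $p\in X^2$. $(X,2,\ast_1,\star)$ is a $DT$-$2$-field if $(X,\ast_1,\star)$ is a field (additive operation $\ast_1$, multiplicative operation $\star$) and: (1) $(x,y)\mapsto x\ast_1 y$ is $(G_4,2)$-continuous; (2) the map $X\to X$ sending $x$ to its $\ast_1$-inverse is $2$-continuous; (3) $(x,y)\mapsto x\star y$ is $(G_4,2)$-continuous; (4) with $x_0$ the identity of $\ast_1$ and $X'=X\setminus\{x_0\}$, the map $X'\to X'$ sending $x$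 to its $\star$-inverse is $2$-continuous on $(X',2)$. *)

(* Defs.v *)
From HB Require Import structures.
From mathcomp Require Import all_boot all_order all_algebra.
From mathcomp Require Import boolp classical_sets.

Set Implicit Arguments.
Unset Strict Implicit.
Unset Printing Implicit Defensive.

Import Order.TTheory GRing.Theory Num.Theory.
Local Open Scope classical_set_scope.
Local Open Scope ring_scope.

(* A subset X of the integers is a [set int]; its points form the type
   [set_type X] = {x : int | x \in X}, to which X coerces. *)

Definition N2 (X : set int) (x : X) : set X :=
  [set y : X | `|val x - val y| <= 1].

Definition continuous2 (X : set int) (f : X -> X) : Prop :=
  forall x : X, f @` N2 x `<=` N2 (f x).

Definition G4_adjacent (X : set int) (p q : X * X) : Prop :=
  p <> q /\ ((N2 p.1 `*` [set p.2]) `|` ([set p.1] `*` N2 p.2)) q.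

Definition NG4 (X : set int) (p : X * X) : set (X * X) :=
  [set q | G4_adjacent p q] `|` [set p].

Definition continuousG4 (X : set int) (f : X * X -> X) : Prop :=
  forall p : X * X, f @` NG4 p `<=` N2 (f p).

Section NonzeroPart.
Variables (X : set int) (cF : GRing.Field X).

Definition field_of : fieldType := GRing.Field.Pack cF.

Definition nonzero : set int := X `\ val (0 : field_of).

Lemma nonzero_mem (x : nonzero) : val x \in X.
Proof. by case: x => x /= /set_mem [Xx _]; apply/mem_set. Qed.

Definition nonzero_incl (x : nonzero) : field_of :=
  exist _ (val x) (nonzero_mem x).

Lemma nonzero_inv_mem (x : nonzero) :
  val ((nonzero_incl x)^-1 : field_of) \in nonzero.
Proof.
apply/mem_set; split; first by apply/set_mem; apply: valP.
move=> /val_inj xV0; have /eqP : (nonzero_incl x)^-1 = 0 := xV0.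
rewrite invr_eq0 => /eqP x0.
have /set_mem[_] := valP x; apply; exact: (congr1 val x0).
Qed.

Definition nonzero_inv (x : nonzero) : nonzero :=
  exist _ (val ((nonzero_incl x)^-1 : field_of)) (nonzero_inv_mem x).

End NonzeroPart.

(* The operations [add] and [mul] determine the whole field structure [cF],
   including 0, 1, opposites and the inverses of nonzero elements. *)
Definition is_DT_2_field (X : set int) (add mul : X -> X -> X) : Prop :=
  exists cF : GRing.Field X,
    let F := field_of cF in
    [/\ (forall x y : F, x + y = add x y) /\ (forall x y : F, x * y = mul x y),
        continuousG4 (fun p : X * X => add p.1 p.2),
        continuous2 (fun x : X => - (x : F)),
        continuousG4 (fun p : X * X => mul p.1 p.2) &
        continuous2 (@nonzero_inv X cF)].

Definition Y : set int := [set 0; 1].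

Definition Y0 : Y := exist _ (0 : int) (mem_set (or_introl erefl)).
Definition Y1 : Y := exist _ (1 : int) (mem_set (or_intror erefl)).

Definition addY (x y : Y) : Y :=
  if x == Y0 then y else if y == Y0 then x else Y0.

Definition mulY (x y : Y) : Y :=
  if (x == Y1) && (y == Y1) then Y1 else Y0.

Lemma addY11 : addY Y1 Y1 = Y0.
Proof. by []. Qed.

Lemma addY0 (x : Y) : addY x Y0 = x.
Proof. by rewrite /addY eqxx; case: eqP => // ->. Qed.

Lemma add0Y (x : Y) : addY Y0 x = x.
Proof. by rewrite /addY eqxx. Qed.

Lemma mulY11 : mulY Y1 Y1 = Y1.
Proof. by rewrite /mulY eqxx. Qed.

Lemma mulY0 (x : Y) : mulY x Y0 = Y0.
Proof. by rewrite /mulY andbF. Qed.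

Lemma mul0Y (x : Y) : mulY Y0 x = Y0.
Proof. by []. Qed.

(* Main.v *)
From HB Require Import structures.
From mathcomp Require Import all_boot all_order all_algebra.
From mathcomp Require Import boolp classical_sets.
Require Import Defs.

Import Order.TTheory GRing.Theory Num.Theory.
Local Open Scope classical_set_scope.
Local Open Scope ring_scope.

(* Any two points of {0,1} differ by at most 1, so every 2-neighbourhood in a
   subset of {0,1} is the whole subset and all continuity conditions hold
   trivially; the field is the prime field with two elements. *)

(** After this split the equality tests in [addY] and [mulY] concern closed points and evaluate, so
    algebraic laws become finite checks. *)
Lemma Y_cases (x : Y) : x = Y0 \/ x = Y1.
Proof.
by case: (set_mem (valP x)) => /= vx; [left|right]; apply/val_inj.
Qed.

(** Allowing any [X] inside [Y] covers both [Y] itself and its nonzero part, on which inversion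
    acts. *)
Lemma N2_full (X : set int) (x y : X) : X `<=` Y -> N2 x y.
Proof.
move=> XY; rewrite /N2 /=.
have /XY[] := set_mem (valP x); have /XY[] := set_mem (valP y);
  by move=> /= -> ->.
Qed.

Lemma continuous2_subY (X : set int) (f : X -> X) : X `<=` Y -> continuous2 f.
Proof. by move=> XY x y _; exact: N2_full. Qed.

Lemma continuousG4_subY (X : set int) (f : X * X -> X) :
  X `<=` Y -> continuousG4 f.
Proof. by move=> XY p y _; exact: N2_full. Qed.

(** A separate name to carry the algebraic instances; it unfolds to [Y], so its field class is also
    one on [Y]. *)
Definition fieldY : Type := set_type Y.
HB.instance Definition _ := Choice.on fieldY.

Lemma addYC : commutative addY.
Proof. by move=> x y; case: (Y_cases x) (Y_cases y) => -> [] ->. Qed.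

Lemma addYA : associative addY.
Proof.
by move=> x y z; case: (Y_cases x) (Y_cases y) (Y_cases z) => -> [] -> [] ->.
Qed.

Lemma addYY (x : Y) : addY x x = Y0.
Proof. by case: (Y_cases x) => ->. Qed.

(** In characteristic 2 each element is its own opposite, hence [id]. *)
HB.instance Definition _ :=
  @GRing.isZmodule.Build fieldY Y0 id addY addYA addYC add0Y addYY.

Lemma mulYC : commutative mulY.
Proof. by move=> x y; rewrite /mulY andbC. Qed.

Lemma mulYA : associative mulY.
Proof.
by move=> x y z; case: (Y_cases x) (Y_cases y) (Y_cases z) => -> [] -> [] ->.
Qed.

Lemma mul1Y : left_id Y1 mulY.
Proof. by move=> x; case: (Y_cases x) => ->. Qed.

Lemma mulYDl : left_distributive mulY addY.
Proof.
by move=> x y z; case: (Y_cases x) (Y_cases y) (Y_cases z) => -> [] -> [] ->.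
Qed.

Lemma Y1_neq0 : Y1 != Y0.
Proof. by []. Qed.

HB.instance Definition _ := @GRing.Zmodule_isComNzRing.Build fieldY
  Y1 mulY mulYA mulYC mul1Y mulYDl Y1_neq0.

Lemma mulYY (x : fieldY) : x != 0 -> (x : fieldY) * x = 1.
Proof. by case: (Y_cases x) => ->. Qed.

(** The only nonzero element, 1, is its own inverse; [id] also respects the convention that 0
    inverts to 0, which [erefl] checks. *)
HB.instance Definition _ :=
  @GRing.ComNzRing_isField.Build fieldY id mulYY erefl.

Theorem theorem5p5 : is_DT_2_field addY mulY.
Proof.
(* The ring operations of [fieldY] unfold to [addY] and [mulY], so the agreement clause holds by
   conversion. *)
exists (GRing.Field.class fieldY); split => //.
- exact: continuousG4_subY.
- exact: continuous2_subY.
- exact: continuousG4_subY.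
- by apply: continuous2_subY => x [].
Qed.
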